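(* Let $\varepsilon>0$ and $L>0$, and consider the energy functional (deployable ladder with $\widehat{\mathcal U}_0=0$) $$\mathscr E[\theta]=\int_0^L \tfrac12\,\theta'(R)^2+\varepsilon\cos 2\theta(R)\,\mathrm dR$$ with free endpoint values, whose equilibria are the solutions of $\theta''+2\varepsilon\sin 2\theta=0$ on $[0,L]$ with $\theta'(0)=\theta'(L)=0$. (i) The constant equilibria $\theta\equiv\pi/2$ and $\theta\equiv-\pi/2$ (helical configurations) are stable, i.e. local minima of $\mathscr E$, while the constant equilibrium $\theta\equiv 0$ (straight configuration) is unstable, i.e. not a local minimum of $\mathscr E$. (ii) Every equilibrium with $k$ perversions, for any integer $k\ge 1$, is unstable, i.e. is not a local minimum of $\mathscr E$.
   Context: The scalar $\theta(R)$ is the angle between the tangents of the two flanges of the ladder at reference arc length $R\in[0,L]$. ''Local minimum'' is understood among all nearby $C^1$ functions on $[0,L]$ (nearness in the $C^1$ norm), with no constraint on the values $\theta(0),\theta(L)$. An equilibrium with $k$ perversions ($k\ge1$) is a non-constant solution $\theta$ of $\theta''+2\varepsilon\sin2\theta=0$ on $[0,L]$ with $\theta'(0)=\theta'(L)=0$ that oscillates in the well of the potential $V(\theta)=-\varepsilon\cos2\theta$ at $\theta=0$, i.e. $-\pi/2<\theta(R)<\pi/2$ for all $R\in[0,L]$, and that crosses $\theta=0$ exactly $k$ times on $[0,L]$. *)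

(* Defs.v *)
From Stdlib Require Import Reals List.
From Coquelicot Require Import Coquelicot.
Open Scope R_scope.

Definition in_Icc (a b x : R) : Prop := a <= x <= b.

(* C^1 functions on [0,L]. Derivatives are taken within [0,L], hence one-sided
   at the endpoints. The values of both fields outside [0,L] are irrelevant. *)
Record C1fun (L : R) : Type := mkC1fun {
  c1_val :> R -> R;
  c1_der : R -> R;
  c1_derP : forall x, in_Icc 0 L x -> D_in c1_val c1_der (in_Icc 0 L) x;
  c1_contP : forall x, in_Icc 0 L x -> continue_in c1_der (in_Icc 0 L) x
}.

Arguments c1_val {L} _ _.
Arguments c1_der {L} _ _.
Arguments c1_derP {L} _ _ _.
Arguments c1_contP {L} _ _ _.

Definition c1_const (L a : R) : C1fun L :=
  mkC1fun L (fun _ => a) (fun _ => 0)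
    (fun x _ => Dconst (in_Icc 0 L) a x)
    (fun x _ => cont_deriv _ _ _ _ (Dconst (in_Icc 0 L) 0 x)).

Definition sup_norm (L : R) (f : R -> R) : Rbar :=
  Lub_Rbar (fun r => exists x, in_Icc 0 L x /\ r = Rabs (f x)).

Definition C1_dist {L : R} (theta phi : C1fun L) : Rbar :=
  Rbar_plus (sup_norm L (fun x => phi x - theta x))
            (sup_norm L (fun x => c1_der phi x - c1_der theta x)).

Definition energy (eps : R) {L : R} (theta : C1fun L) : R :=
  RInt (fun x => / 2 * (c1_der theta x) ^ 2 + eps * cos (2 * theta x)) 0 L.

Definition local_min (eps : R) {L : R} (theta : C1fun L) : Prop :=
  exists delta : R, 0 < delta /\
    forall phi : C1fun L, Rbar_lt (C1_dist theta phi) (Finite delta) ->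
      energy eps theta <= energy eps phi.

Definition stable (eps : R) {L : R} (theta : C1fun L) : Prop :=
  local_min eps theta.

Definition unstable (eps : R) {L : R} (theta : C1fun L) : Prop :=
  ~ local_min eps theta.

Definition equilibrium (eps : R) {L : R} (theta : C1fun L) : Prop :=
  (exists theta2 : R -> R, forall x, in_Icc 0 L x ->
     D_in (c1_der theta) theta2 (in_Icc 0 L) x /\
     theta2 x + 2 * eps * sin (2 * theta x) = 0) /\
  c1_der theta 0 = 0 /\ c1_der theta L = 0.

(* A crossing is a zero at which the sign changes, so it lies in ]0,L[. *)
Definition crosses_zero_at {L : R} (theta : C1fun L) (c : R) : Prop :=
  theta c = 0 /\
  exists eta : R, 0 < eta /\ 0 <= c - eta /\ c + eta <= L /\
    forall x y, c - eta < x < c -> c < y < c + eta -> theta x * theta y < 0.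

Definition crosses_zero_exactly (k : nat) {L : R} (theta : C1fun L) : Prop :=
  exists s : list R, NoDup s /\ length s = k /\
    forall c, In c s <-> crosses_zero_at theta c.

Definition perversion_equilibrium (eps : R) (k : nat) {L : R}
    (theta : C1fun L) : Prop :=
  equilibrium eps theta /\
  (~ exists a : R, forall x, in_Icc 0 L x -> theta x = a) /\
  (forall x, in_Icc 0 L x -> - (PI / 2) < theta x < PI / 2) /\
  crosses_zero_exactly k theta.

(* Main.v *)
Require Import Defs.
From Stdlib Require Import Reals List Lra.
From Coquelicot Require Import Coquelicot.
Open Scope R_scope.

(** Two facts carry the theorem.

    The energy density is at least [- eps], and the constants [PI / 2] and
    [- (PI / 2)] attain this bound everywhere: they are global minimizers.

    Let [u] be an equilibrium with values in the well [(-PI/2, PI/2)]; the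
    straight configuration and all equilibria with perversions are of this
    kind.  The first integral of the pendulum equation, together with
    [u'(0) = 0], reads [u'^2 = 4 eps (cos u ^2 - kappa)] where
    [kappa = cos (u 0) ^2 > 0].  It implies that [h = cos u] satisfies
    [h'' + 4 eps cos (2 u) h = 4 eps kappa h] and [h' = 0] at both ends, so [h]
    is an eigenfunction of the second variation of the energy (the dnoidal
    ground state of a Lame operator), with the negative eigenvalue
    [- 4 eps kappa].  Hence the energy decreases along [u + t cos u] for small
    [t > 0].

    The decrease is made quantitative pointwise: the change of the density is
    at most the derivative of a function vanishing at both ends, minus
    [2 eps t^2 (kappa^2 - t)] ([density_change]); integrating gives the claim
    ([well_equilibrium_unstable]). *)

(** * Functions on a closed interval and their continuous extension *)

(** Composing with the retraction of [R] onto [[0, L]] turns continuity within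
    the interval into plain continuity, as the integral and the mean value
    theorem require. *)
Definition clamp (L x : R) : R := Rmax 0 (Rmin x L).

Lemma clamp_Icc L x : 0 < L -> in_Icc 0 L (clamp L x).
Proof.
intros HL; unfold clamp, in_Icc, Rmax, Rmin.
repeat destruct Rle_dec; lra.
Qed.

Lemma clamp_id L x : in_Icc 0 L x -> clamp L x = x.
Proof.
unfold clamp, in_Icc, Rmax, Rmin; intros Hx.
repeat destruct Rle_dec; lra.
Qed.

Lemma clamp_lipschitz L x y : Rabs (clamp L x - clamp L y) <= Rabs (x - y).
Proof.
unfold clamp, Rmax, Rmin, Rabs.
repeat destruct Rle_dec; repeat destruct Rcase_abs; lra.
Qed.

Lemma continuous_clamp L (f : R -> R) (HL : 0 < L) :
  (forall x, in_Icc 0 L x -> continue_in f (in_Icc 0 L) x) ->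
  forall x, continuous (fun y => f (clamp L y)) x.
Proof.
intros Hf x; apply continuity_pt_filterlim.
intros e He.
destruct (Hf (clamp L x) (clamp_Icc L x HL) e He) as [d [Hd H]].
exists d; split; [exact Hd|].
intros y [_ Hy]; simpl in *; unfold R_dist in *.
destruct (Req_dec (clamp L x) (clamp L y)) as [E|N].
- rewrite E, Rminus_diag, Rabs_R0; exact He.
- apply H; repeat split; try apply clamp_Icc; auto.
  eapply Rle_lt_trans; [apply clamp_lipschitz|exact Hy].
Qed.

Lemma continue_in_of_clamp L (f : R -> R) :
  (forall x, continuous (fun y => f (clamp L y)) x) ->
  forall x, in_Icc 0 L x -> continue_in f (in_Icc 0 L) x.
Proof.
intros Hf x Hx e He.
destruct (proj2 (continuity_pt_filterlim _ x) (Hf x) e He) as [d [Hd H]].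
exists d; split; [exact Hd|].
intros y [[Hy Hxy] Hyd]; simpl in *; unfold R_dist in *.
rewrite <- (clamp_id L y Hy), <- (clamp_id L x Hx).
apply H; repeat split; auto.
Qed.

Lemma is_derive_clamp L (f d : R -> R) x :
  0 < x < L -> D_in f d (in_Icc 0 L) x ->
  is_derive (fun y => f (clamp L y)) x (d x).
Proof.
intros Hx Hf.
apply (is_derive_ext_loc f).
- assert (Hr : 0 < Rmin x (L - x)) by (apply Rmin_pos; lra).
  exists (mkposreal _ Hr); intros y Hy.
  change (Rabs (y - x) < Rmin x (L - x)) in Hy.
  rewrite clamp_id; [reflexivity|].
  apply Rabs_def2 in Hy.
  assert (H1 := Rmin_l x (L - x)); assert (H2 := Rmin_r x (L - x)).
  unfold in_Icc; lra.
- apply is_derive_Reals; intros e He.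
  destruct (Hf e He) as [r [Hr H]].
  assert (Hm : 0 < Rmin r (Rmin x (L - x))) by (repeat apply Rmin_pos; lra).
  exists (mkposreal _ Hm); intros h Hh Hhd; simpl in Hhd.
  assert (H1 := Rmin_l r (Rmin x (L - x))).
  assert (H2 := Rmin_r r (Rmin x (L - x))).
  assert (H3 := Rmin_l x (L - x)); assert (H4 := Rmin_r x (L - x)).
  assert (Hb := Hhd); apply Rabs_def2 in Hb.
  specialize (H (x + h)); simpl in H; unfold R_dist, D_x, in_Icc in H.
  replace (x + h - x) with h in H by ring.
  apply H; repeat split; lra.
Qed.

(** Integrating the inequality [f <= F' - m], where [F] need only be
    differentiable inside the interval: the mean value theorem is applied to
    the difference between the primitive of [f] and [F]. *)
Lemma RInt_le_increment (L m : R) (f F dF : R -> R) :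
  0 < L -> (forall x, continuous f x) -> (forall x, continuous F x) ->
  (forall x, 0 < x < L -> is_derive F x (dF x)) ->
  (forall x, in_Icc 0 L x -> f x <= dF x - m) ->
  RInt f 0 L <= F L - F 0 - m * L.
Proof.
intros HL Hf HF HdF Hle.
assert (Hprim : forall x, is_derive (fun y => RInt f 0 y) x (f x)).
{ intros x; apply (is_derive_RInt f _ 0); [|apply Hf].
  exists (mkposreal 1 Rlt_0_1); intros y _.
  apply (RInt_correct f 0 y), (ex_RInt_continuous f).
  intros z _; apply Hf. }
destruct (MVT_gen (fun x => RInt f 0 x - F x) 0 L (fun x => f x - dF x))
  as [c [Hc E]].
- rewrite Rmin_left, Rmax_right by lra; intros x Hx.
  apply (is_derive_minus (fun y => RInt f 0 y) F); auto.
- intros x _; apply continuity_pt_filterlim.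
  apply (continuous_minus (fun y => RInt f 0 y) F); [|apply HF].
  apply (ex_derive_continuous (fun y => RInt f 0 y)); eexists; apply Hprim.
- rewrite Rmin_left, Rmax_right in Hc by lra.
  rewrite RInt_point in E; unfold zero in E; simpl in E.
  specialize (Hle c Hc).
  assert ((f c - dF c) * L <= - m * L) by (apply Rmult_le_compat_r; lra).
  lra.
Qed.

(** * C1 functions and their energy *)

Section Clamped.
Context {L : R} (HL : 0 < L) (theta : C1fun L).

Definition val_ext (x : R) : R := theta (clamp L x).
Definition der_ext (x : R) : R := c1_der theta (clamp L x).

Lemma continuous_val_ext x : continuous val_ext x.
Proof.
apply (continuous_clamp L theta HL); intros y Hy.
exact (cont_deriv _ _ _ _ (c1_derP theta y Hy)).
Qed.

Lemma continuous_der_ext x : continuous der_ext x.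
Proof. apply (continuous_clamp L (c1_der theta) HL), c1_contP. Qed.

Definition density_ext (eps x : R) : R :=
  / 2 * der_ext x ^ 2 + eps * cos (2 * val_ext x).

Lemma continuous_density_ext eps x : continuous (density_ext eps) x.
Proof.
apply (continuous_plus (fun y => / 2 * der_ext y ^ 2)
                       (fun y => eps * cos (2 * val_ext y))).
- apply (continuous_comp der_ext (fun z => / 2 * z ^ 2)).
  + apply continuous_der_ext.
  + apply (ex_derive_continuous (fun z => / 2 * z ^ 2)); auto_derive; auto.
- apply (continuous_comp val_ext (fun z => eps * cos (2 * z))).
  + apply continuous_val_ext.
  + apply (ex_derive_continuous (fun z => eps * cos (2 * z))); auto_derive; auto.
Qed.

Lemma ex_RInt_density_ext eps : ex_RInt (density_ext eps) 0 L.
Proof.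
apply (ex_RInt_continuous (density_ext eps)); intros z _.
apply continuous_density_ext.
Qed.

Lemma energy_density_ext eps : energy eps theta = RInt (density_ext eps) 0 L.
Proof.
apply RInt_ext; intros x Hx; rewrite Rmin_left, Rmax_right in Hx by lra.
unfold density_ext, val_ext, der_ext; rewrite clamp_id; [reflexivity|].
unfold in_Icc; lra.
Qed.

Lemma energy_lower_bound eps : 0 < eps -> - eps * L <= energy eps theta.
Proof.
intros Heps; rewrite energy_density_ext.
replace (- eps * L) with (RInt (fun _ : R => - eps) 0 L)
  by (rewrite RInt_const; unfold scal; simpl; unfold mult; simpl; ring).
apply RInt_le; [lra|apply ex_RInt_const|apply ex_RInt_density_ext|].
intros x _; unfold density_ext.
destruct (COS_bound (2 * val_ext x)); nra.
Qed.

End Clamped.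

(** Nearby competitors are built by postcomposition, since this is how
    [theta + t cos theta] arises. *)
Definition c1_comp {L : R} (HL : 0 < L) (g dg : R -> R)
    (Hg : forall y, is_derive g y (dg y)) (Hdg : forall y, continuous dg y)
    (theta : C1fun L) : C1fun L.
Proof.
refine (mkC1fun L (fun x => g (theta x))
                  (fun x => c1_der theta x * dg (theta x)) _ _).
- intros x Hx.
  assert (Hy : D_in g dg no_cond (theta x)).
  { apply derivable_pt_lim_D_in, is_derive_Reals, Hg. }
  assert (H := Dcomp _ _ _ _ _ _ _ (c1_derP theta x Hx) Hy).
  intros e He; destruct (H e He) as [d [Hd K]].
  exists d; split; [exact Hd|]; intros y [[Hy1 Hy2] Hy3]; apply K.
  repeat split; try exact I; auto; apply Hy1.
- apply continue_in_of_clamp; intros x.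
  apply (continuous_mult (der_ext theta) (fun y => dg (val_ext theta y))).
  + apply continuous_der_ext, HL.
  + apply (continuous_comp (val_ext theta) dg); [|apply Hdg].
    apply continuous_val_ext, HL.
Defined.

Lemma sup_norm_le (L M : R) (f : R -> R) :
  (forall x, in_Icc 0 L x -> Rabs (f x) <= M) -> Rbar_le (sup_norm L f) M.
Proof.
intros H.
apply (proj2 (Lub_Rbar_correct (fun r => exists x, in_Icc 0 L x /\ r = Rabs (f x)))).
intros r [x [Hx ->]]; apply H, Hx.
Qed.

Lemma C1_dist_lt {L : R} (theta phi : C1fun L) (M N delta : R) :
  (forall x, in_Icc 0 L x -> Rabs (phi x - theta x) <= M) ->
  (forall x, in_Icc 0 L x -> Rabs (c1_der phi x - c1_der theta x) <= N) ->
  M + N < delta -> Rbar_lt (C1_dist theta phi) delta.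
Proof.
intros H1 H2 H.
apply (Rbar_le_lt_trans _ (Rbar_plus M N)); [|exact H].
apply Rbar_plus_le_compat; apply sup_norm_le; assumption.
Qed.

(** * The helical configurations *)

Lemma minimal_const_stable (eps L a : R) :
  0 < eps -> 0 < L -> cos (2 * a) = -1 -> stable eps (c1_const L a).
Proof.
intros Heps HL Ha; exists 1; split; [lra|]; intros phi _.
eapply Rle_trans; [|apply energy_lower_bound; assumption].
unfold energy; simpl; rewrite RInt_const, Ha.
unfold scal; simpl; unfold mult; simpl; lra.
Qed.

Lemma const_equilibrium (eps L a : R) :
  sin (2 * a) = 0 -> equilibrium eps (c1_const L a).
Proof.
intros Ha; split; [|split; reflexivity].
exists (fun _ => 0); intros x Hx; split.
- exact (Dconst (in_Icc 0 L) 0 x).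
- simpl; rewrite Ha; ring.
Qed.

(** * Equilibria inside the well *)

Lemma pendulum_ext (eps L : R) (theta : C1fun L) (th2 : R -> R) (x : R) :
  (forall y, in_Icc 0 L y -> D_in (c1_der theta) th2 (in_Icc 0 L) y /\
                             th2 y + 2 * eps * sin (2 * theta y) = 0) ->
  0 < x < L ->
  is_derive (val_ext theta) x (der_ext theta x) /\
  is_derive (der_ext theta) x (- (2 * eps * sin (2 * val_ext theta x))).
Proof.
intros Heq Hx.
assert (Hx' : in_Icc 0 L x) by (unfold in_Icc; lra).
destruct (Heq x Hx') as [Hd2 E2]; split.
- unfold der_ext; rewrite (clamp_id L x Hx').
  apply is_derive_clamp; [lra|apply c1_derP, Hx'].
- replace (- (2 * eps * sin (2 * val_ext theta x))) with (th2 x)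
    by (unfold val_ext; rewrite clamp_id by exact Hx'; lra).
  apply is_derive_clamp; assumption.
Qed.

(** Conservation of [u'^2 / 2 - eps cos (2 u)], whose value is known at [0]
    because [u' = 0] there. *)
Lemma first_integral (eps L : R) (theta : C1fun L) (HL : 0 < L) :
  equilibrium eps theta ->
  forall x, in_Icc 0 L x ->
    c1_der theta x ^ 2 = 4 * eps * (cos (theta x) ^ 2 - cos (theta 0) ^ 2).
Proof.
intros [[th2 Heq] [H0 _]] x Hx.
set (u := val_ext theta); set (v := der_ext theta).
destruct (MVT_gen (fun y => v y ^ 2 - 4 * eps * cos (u y) ^ 2) 0 x (fun _ => 0))
  as [c [_ E]].
- destruct Hx as [Hx0 HxL]; rewrite Rmin_left, Rmax_right by lra; intros y Hy.
  destruct (pendulum_ext eps L theta th2 y Heq) as [Hu Hv];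
    [lra|fold u v in Hu, Hv].
  auto_derive.
  + repeat split; eexists; eassumption.
  + rewrite (is_derive_unique (fun z : R => u z) _ _ Hu),
      (is_derive_unique (fun z : R => v z) _ _ Hv).
    rewrite sin_2a; ring.
- intros y _; apply continuity_pt_filterlim.
  apply (continuous_minus (fun y => v y ^ 2) (fun y => 4 * eps * cos (u y) ^ 2)).
  + apply (continuous_comp v (fun z => z ^ 2)).
    * apply continuous_der_ext, HL.
    * apply (ex_derive_continuous (fun z => z ^ 2)); auto_derive; auto.
  + apply (continuous_comp u (fun z => 4 * eps * cos z ^ 2)).
    * apply continuous_val_ext, HL.
    * apply (ex_derive_continuous (fun z => 4 * eps * cos z ^ 2)).
      auto_derive; auto.
- assert (Z : in_Icc 0 L 0) by (unfold in_Icc; lra).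
  unfold u, v, val_ext, der_ext in E.
  rewrite (clamp_id L x Hx), (clamp_id L 0 Z), H0 in E; lra.
Qed.

Lemma cos_sin_taylor (y : R) : 0 <= y <= 2 ->
  Rabs (cos y - 1 + y ^ 2 / 2) <= y ^ 4 / 24 /\
  Rabs (sin y - y) <= y ^ 3 / 6.
Proof.
intros Hy; split.
- destruct (pre_cos_bound y 0) as [H1 H2]; [lra|lra|].
  unfold cos_approx, cos_term in H1, H2; simpl in H1, H2.
  apply Rabs_le; split; [|lra].
  assert (0 <= y ^ 4) by (apply pow_le; lra); lra.
- destruct (pre_sin_bound y 0) as [H1 _]; [lra|lra|].
  unfold sin_approx, sin_term in H1; simpl in H1.
  assert (0 <= y ^ 3) by (apply pow_le; lra).
  assert (sin y <= y).
  { destruct (Req_dec y 0) as [->|N]; [rewrite sin_0; lra|].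
    left; apply sin_lt_x; lra. }
  apply Rabs_le; split; lra.
Qed.

(** The potential along [u + t cos u], expanded to second order; the argument
    is increased by [2 t c] with [0 <= c <= 1], so the remainder is cubic in
    [t]. *)
Lemma cos_increment (u c t : R) : 0 <= c <= 1 -> 0 <= t <= 1 ->
  cos (2 * u + 2 * t * c) - cos (2 * u)
  <= - 2 * t * c * sin (2 * u) - 2 * t ^ 2 * c ^ 2 * cos (2 * u) + 2 * t ^ 3.
Proof.
intros Hc Ht; set (y := 2 * t * c).
assert (Hy : 0 <= y <= 2 * t) by (unfold y; nra).
destruct (cos_sin_taylor y) as [H1 H2]; [lra|].
rewrite cos_plus.
assert (B1 : y ^ 3 <= 8 * t ^ 3).
{ replace (8 * t ^ 3) with ((2 * t) ^ 3) by ring; apply pow_incr; lra. }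
assert (B2 : y ^ 4 <= 16 * t ^ 3).
{ apply (Rle_trans _ ((2 * t) ^ 4)); [apply pow_incr; lra|].
  assert (0 <= t ^ 3) by (apply pow_le; lra); nra. }
assert (K1 : cos (2 * u) * (cos y - 1 + y ^ 2 / 2) <= y ^ 4 / 24).
{ eapply Rle_trans; [apply Rle_abs|rewrite Rabs_mult].
  assert (Rabs (cos (2 * u)) <= 1) by (apply Rabs_le, COS_bound).
  assert (0 <= Rabs (cos y - 1 + y ^ 2 / 2)) by apply Rabs_pos; nra. }
assert (K2 : - sin (2 * u) * (sin y - y) <= y ^ 3 / 6).
{ eapply Rle_trans; [apply Rle_abs|rewrite Rabs_mult, Rabs_Ropp].
  assert (Rabs (sin (2 * u)) <= 1) by (apply Rabs_le, SIN_bound).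
  assert (0 <= Rabs (sin y - y)) by apply Rabs_pos; nra. }
replace (2 * t ^ 2 * c ^ 2) with (y ^ 2 / 2) by (unfold y; field).
replace (- 2 * t * c) with (- y) by (unfold y; ring).
assert (0 <= t ^ 3) by (apply pow_le; lra).
lra.
Qed.

(** With [v = u'], the bracket on the right-hand side is the derivative of
    [t cos u v - t^2 / 2 * cos u sin u v] along the flow [u' = v],
    [v' = - 2 eps sin (2 u)]: the first term absorbs the first variation, the
    second is the boundary term [h h'] of the second variation at [h = cos u].
    What is left of the second variation is [- 2 eps kappa t^2 cos u ^2], and
    [cos u ^2 >= kappa] because [v^2 >= 0]. *)
Lemma density_change (eps kappa t u v : R) :
  0 < eps -> 0 <= kappa -> 0 <= t <= 1 -> 0 <= cos u ->
  v ^ 2 = 4 * eps * (cos u ^ 2 - kappa) ->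
  / 2 * (v * (1 - t * sin u)) ^ 2 + eps * cos (2 * (u + t * cos u))
    - (/ 2 * v ^ 2 + eps * cos (2 * u))
  <= (t * (- sin u * v ^ 2 - 2 * eps * sin (2 * u) * cos u)
      - t ^ 2 / 2 * (cos (2 * u) * v ^ 2
                     - 2 * eps * sin (2 * u) * cos u * sin u))
     - 2 * eps * t ^ 2 * (kappa ^ 2 - t).
Proof.
intros Heps Hk Ht Hc Hv.
assert (Hinc := cos_increment u (cos u) t
                  (conj Hc (proj2 (COS_bound u))) Ht).
replace (2 * (u + t * cos u)) with (2 * u + 2 * t * cos u) by ring.
apply (Rmult_le_compat_l eps) in Hinc; [|lra].
assert (Hs : sin u ^ 2 = 1 - cos u ^ 2).
{ assert (H := sin2_cos2 u); unfold Rsqr in H; lra. }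
assert (Hkc : kappa <= cos u ^ 2) by nra.
assert (Hrem : 0 <= eps * t ^ 2 * (kappa * (cos u ^ 2 - kappa))).
{ apply Rmult_le_pos; [nra|]. apply Rmult_le_pos; lra. }
(* the second variation, after removal of its boundary term *)
assert (Hsec : t ^ 2 / 2 * (sin u ^ 2 * v ^ 2
                            - 4 * eps * cos u ^ 2 * cos (2 * u))
   = - (t ^ 2 / 2) * (cos (2 * u) * v ^ 2
                     - 2 * eps * sin (2 * u) * cos u * sin u)
     - 2 * eps * kappa * t ^ 2 * cos u ^ 2).
{ rewrite sin_2a, cos_2a_cos.
  replace (2 * eps * (2 * sin u * cos u) * cos u * sin u)
    with (4 * eps * cos u ^ 2 * sin u ^ 2) by ring.
  rewrite Hs, Hv; field. }
replace (/ 2 * (v * (1 - t * sin u)) ^ 2)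
  with (/ 2 * v ^ 2 - t * sin u * v ^ 2 + t ^ 2 / 2 * (sin u ^ 2 * v ^ 2))
  by field.
nra.
Qed.

Lemma is_derive_push (t y : R) :
  is_derive (fun z => z + t * cos z) y (1 - t * sin y).
Proof. auto_derive; auto; ring. Qed.

Lemma continuous_push_der (t y : R) : continuous (fun z => 1 - t * sin z) y.
Proof.
apply (ex_derive_continuous (fun z => 1 - t * sin z)); auto_derive; auto.
Qed.

Definition push {L : R} (HL : 0 < L) (t : R) (theta : C1fun L) : C1fun L :=
  c1_comp HL _ _ (is_derive_push t) (continuous_push_der t) theta.

Lemma energy_push_le (eps L t : R) (theta : C1fun L) (HL : 0 < L) :
  0 < eps -> equilibrium eps theta ->
  (forall x, in_Icc 0 L x -> 0 <= cos (theta x)) -> 0 <= t <= 1 ->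
  energy eps (push HL t theta) - energy eps theta
  <= - (2 * eps * t ^ 2 * ((cos (theta 0) ^ 2) ^ 2 - t)) * L.
Proof.
intros Heps Heq Hcos Ht.
assert (Hfi := first_integral eps L theta HL Heq).
destruct Heq as [[th2 Heq] [H0 HvL]].
set (m := 2 * eps * t ^ 2 * ((cos (theta 0) ^ 2) ^ 2 - t)).
set (u := val_ext theta); set (v := der_ext theta).
rewrite !energy_density_ext by exact HL.
set (f := fun x => density_ext (push HL t theta) eps x - density_ext theta eps x).
replace (RInt (density_ext (push HL t theta) eps) 0 L
         - RInt (density_ext theta eps) 0 L) with (RInt f 0 L)
  by (apply (RInt_minus (density_ext (push HL t theta) eps));
      apply ex_RInt_density_ext, HL).
set (F := fun x => (t * cos (u x) - t ^ 2 / 2 * (cos (u x) * sin (u x))) * v x).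
assert (HF0 : F 0 = 0).
{ unfold F, v, der_ext; rewrite clamp_id, H0 by (unfold in_Icc; lra); ring. }
assert (HFL : F L = 0).
{ unfold F, v, der_ext; rewrite clamp_id, HvL by (unfold in_Icc; lra); ring. }
replace (- m * L) with (F L - F 0 - m * L) by (rewrite HF0, HFL; ring).
apply RInt_le_increment with
  (dF := fun x =>
     t * (- sin (u x) * v x ^ 2 - 2 * eps * sin (2 * u x) * cos (u x))
      - t ^ 2 / 2 * (cos (2 * u x) * v x ^ 2
                     - 2 * eps * sin (2 * u x) * cos (u x) * sin (u x))).
- exact HL.
- intros x; apply (continuous_minus (density_ext (push HL t theta) eps));
    apply continuous_density_ext, HL.
- intros x.
  apply (continuous_mult
           (fun x => t * cos (u x) - t ^ 2 / 2 * (cos (u x) * sin (u x))) v).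
  + apply (continuous_comp u (fun z => t * cos z - t ^ 2 / 2 * (cos z * sin z))).
    * apply continuous_val_ext, HL.
    * apply (ex_derive_continuous
               (fun z => t * cos z - t ^ 2 / 2 * (cos z * sin z))).
      auto_derive; auto.
  + apply continuous_der_ext, HL.
- intros x Hx.
  destruct (pendulum_ext eps L theta th2 x Heq) as [Hu Hv];
    [lra|fold u v in Hu, Hv].
  unfold F; auto_derive.
  + repeat split; eexists; eassumption.
  + rewrite (is_derive_unique (fun z : R => u z) _ _ Hu),
      (is_derive_unique (fun z : R => v z) _ _ Hv).
    rewrite cos_2a; field.
- intros x Hx.
  assert (Ex : clamp L x = x) by (apply clamp_id, Hx).
  unfold f, density_ext, u, v, val_ext, der_ext; simpl; rewrite Ex.
  apply density_change; auto.
  apply pow2_ge_0.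
Qed.

(** By the first integral, [u'^2 <= 4 eps <= (1 + eps)^2], so [u + t cos u] is
    at distance at most [t (2 + eps)] from [u]. *)
Lemma push_near (eps L t delta : R) (theta : C1fun L) (HL : 0 < L) :
  0 < eps -> equilibrium eps theta -> 0 <= t -> t * (2 + eps) < delta ->
  Rbar_lt (C1_dist theta (push HL t theta)) delta.
Proof.
intros Heps Heq Ht Hd.
apply (C1_dist_lt _ _ t (t * (1 + eps))); [| |lra]; intros x Hx; simpl.
- replace (theta x + t * cos (theta x) - theta x) with (t * cos (theta x)) by ring.
  rewrite Rabs_mult, (Rabs_pos_eq t Ht).
  assert (Rabs (cos (theta x)) <= 1) by (apply Rabs_le, COS_bound); nra.
- replace (c1_der theta x * (1 - t * sin (theta x)) - c1_der theta x)
    with (t * (- sin (theta x) * c1_der theta x)) by ring.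
  rewrite !Rabs_mult, Rabs_Ropp, (Rabs_pos_eq t Ht).
  apply Rmult_le_compat_l; [exact Ht|].
  assert (Rabs (sin (theta x)) <= 1) by (apply Rabs_le, SIN_bound).
  assert (Rabs (c1_der theta x) <= 1 + eps).
  { rewrite <- (Rabs_pos_eq (1 + eps)) by lra; apply Rsqr_le_abs_0.
    assert (H1 := first_integral eps L theta HL Heq x Hx).
    assert (H2 := pow2_ge_0 (cos (theta 0))).
    assert (H3 : cos (theta x) ^ 2 <= 1).
    { destruct (COS_bound (theta x)); nra. }
    assert (H4 : c1_der theta x ^ 2 <= 4 * eps * 1).
    { rewrite H1; apply Rmult_le_compat_l; lra. }
    assert (H5 := pow2_ge_0 (1 - eps)).
    unfold Rsqr; lra. }
  assert (P1 := Rabs_pos (sin (theta x))).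
  assert (P2 := Rabs_pos (c1_der theta x)); nra.
Qed.

Lemma well_equilibrium_unstable (eps L : R) (theta : C1fun L) :
  0 < eps -> 0 < L -> equilibrium eps theta ->
  (forall x, in_Icc 0 L x -> - (PI / 2) < theta x < PI / 2) ->
  unstable eps theta.
Proof.
intros Heps HL Heq Hwell [delta [Hdelta Hmin]].
assert (Hcos : forall x, in_Icc 0 L x -> 0 < cos (theta x)).
{ intros x Hx; apply cos_gt_0; apply (Hwell x Hx). }
set (k := (cos (theta 0) ^ 2) ^ 2).
assert (Hk : 0 < k).
{ apply pow_lt, pow_lt, Hcos; unfold in_Icc; lra. }
assert (Hq : 0 < delta / (2 + eps)) by (apply Rdiv_lt_0_compat; lra).
set (b := Rmin k (Rmin 1 (delta / (2 + eps)))).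
assert (Hb : 0 < b) by (repeat apply Rmin_pos; lra).
assert (Hbk : b <= k) by apply Rmin_l.
assert (Hb' : b <= Rmin 1 (delta / (2 + eps))) by apply Rmin_r.
assert (Hb1 := Rmin_l 1 (delta / (2 + eps))).
assert (Hb2 := Rmin_r 1 (delta / (2 + eps))).
assert (Hnear : b / 2 * (2 + eps) < delta).
{ replace delta with (delta / (2 + eps) * (2 + eps)) by (field; lra).
  apply Rmult_lt_compat_r; lra. }
assert (Ht : 0 <= b / 2 <= 1) by lra.
assert (Hle := Hmin _ (push_near eps L (b / 2) delta theta HL Heps Heq
                         (proj1 Ht) Hnear)).
assert (Hlt := energy_push_le eps L (b / 2) theta HL Heps Heq
                 (fun x Hx => Rlt_le _ _ (Hcos x Hx)) Ht).
fold k in Hlt.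
assert (0 < 2 * eps * (b / 2) ^ 2 * (k - b / 2) * L).
{ repeat apply Rmult_lt_0_compat; lra. }
lra.
Qed.

Theorem mainTheorem1 (eps L : R) (heps : 0 < eps) (hL : 0 < L) :
  ((equilibrium eps (c1_const L (PI / 2)) /\ stable eps (c1_const L (PI / 2))) /\
   (equilibrium eps (c1_const L (- (PI / 2))) /\
      stable eps (c1_const L (- (PI / 2)))) /\
   (equilibrium eps (c1_const L 0) /\ unstable eps (c1_const L 0))) /\
  (forall k : nat, (1 <= k)%nat -> forall theta : C1fun L,
     perversion_equilibrium eps k theta -> unstable eps theta).
Proof.
assert (Ep : 2 * (PI / 2) = PI) by field.
assert (Em : 2 * - (PI / 2) = - PI) by field.
assert (E0 : equilibrium eps (c1_const L 0)).
{ apply const_equilibrium; rewrite Rmult_0_r; apply sin_0. }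
split; [split; [|split]; split|].
- apply const_equilibrium; rewrite Ep; apply sin_PI.
- apply minimal_const_stable; auto; rewrite Ep; apply cos_PI.
- apply const_equilibrium; rewrite Em, sin_neg, sin_PI; ring.
- apply minimal_const_stable; auto; rewrite Em, cos_neg; apply cos_PI.
- exact E0.
- apply well_equilibrium_unstable; auto.
  intros x _; simpl; assert (H := PI_RGT_0); lra.
- intros k _ theta [Heq [_ [Hwell _]]].
  apply well_equilibrium_unstable; assumption.
Qed.
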